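(* Let $f,g:\mathbb{R}^n\to(-\infty,+\infty]$ be proper, lower semicontinuous and prox-bounded with thresholds $\lambda_f,\lambda_g>0$, let $0<\mu<\bar\lambda=\min\{\lambda_f,\lambda_g\}$, and for $\alpha\in[0,1]$ let $\varphi^{\alpha}_{\mu}=-e_{\mu}(-\alpha e_{\mu}f-(1-\alpha)e_{\mu}g)$. Then the function $\alpha\mapsto\varphi^{\alpha}_{\mu}$ is continuous on $[0,1]$ with respect to the epi-topology; that is, for every sequence $(\alpha_k)_{k\in\mathbb{N}}$ and $\alpha$ in $[0,1]$, if $\alpha_k\to\alpha$ then $\varphi^{\alpha_k}_{\mu}$ epi-converges to $\varphi^{\alpha}_{\mu}$. In particular, $\varphi^{\alpha}_{\mu}$ epi-converges to $h_{\mu}g$ when $\alpha\downarrow0$, and $\varphi^{\alpha}_{\mu}$ epi-converges to $h_{\mu}f$ when $\alpha\uparrow1$.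
   Context: $\|\cdot\|$ is the Euclidean norm. For a proper function $f$ and $\mu>0$, $e_{\mu}f(x)=\inf_{w}\{f(w)+\frac{1}{2\mu}\|w-x\|^2\}$ and the proximal hull is $h_{\mu}f(x)=\sup_{w}\{e_{\mu}f(w)-\frac{1}{2\mu}\|x-w\|^2\}=-e_\mu(-e_\mu f)(x)$. $f$ is prox-bounded if there exist $\lambda>0$ and $x$ with $e_{\lambda}f(x)>-\infty$; the supremum of all such $\lambda$ is its threshold $\lambda_f\in(0,+\infty]$. $(f_k)$ epi-converges to $f$ if for every $x\in\mathbb{R}^n$: (i) $f(x)\le\liminf_k f_k(x_k)$ for every sequence $x_k\to x$; (ii) there is a sequence $y_k\to x$ with $\limsup_k f_k(y_k)\le f(x)$. The epi-topology is the topology induced by epi-convergence; epi-convergence along a continuous parameter means along every sequence of parameters converging to the limit. *)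

(* Defs.v *)
From mathcomp Require Import all_boot all_order all_algebra.
From mathcomp Require Import all_classical all_reals all_analysis.

Set Implicit Arguments.
Unset Strict Implicit.
Unset Printing Implicit Defensive.

Import Order.TTheory GRing.Theory Num.Theory.
Import numFieldNormedType.Exports.

Local Open Scope classical_set_scope.
Local Open Scope ring_scope.
Local Open Scope ereal_scope.

(* The library's `|x| on 'rV[R]_n is the sup norm; its topology, used for
   convergence below, is the usual one on R^n. *)
Definition eucl_norm (R : realType) (n : nat) (x : 'rV[R]_n) : R :=
  Num.sqrt (\sum_(i < n) x ord0 i ^+ 2)%R.

(* The value -oo is excluded: this encodes functions into (-oo, +oo]. *)
Definition proper_fun (R : realType) (n : nat) (f : 'rV[R]_n -> \bar R) : Prop :=
  (forall x, -oo < f x) /\ (exists x, f x < +oo).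

Definition moreau_env (R : realType) (n : nat) (mu : R)
    (f : 'rV[R]_n -> \bar R) (x : 'rV[R]_n) : \bar R :=
  ereal_inf (range (fun w : 'rV[R]_n =>
    f w + ((2 * mu)^-1 * eucl_norm (w - x) ^+ 2)%:E)).

Definition proximal_hull (R : realType) (n : nat) (mu : R)
    (f : 'rV[R]_n -> \bar R) (x : 'rV[R]_n) : \bar R :=
  ereal_sup (range (fun w : 'rV[R]_n =>
    moreau_env mu f w - ((2 * mu)^-1 * eucl_norm (x - w) ^+ 2)%:E)).

Lemma proximal_hullE (R : realType) (n : nat) (mu : R)
    (f : 'rV[R]_n -> \bar R) (x : 'rV[R]_n) :
  proximal_hull mu f x = - moreau_env mu (fun w => - moreau_env mu f w) x.
Proof.
rewrite /proximal_hull {2}/moreau_env ereal_infEN oppeK image_comp.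
congr ereal_sup; apply: eq_imagel => w _ /=.
have -> : eucl_norm (x - w) = eucl_norm (w - x).
  by congr Num.sqrt; apply: eq_bigr => i _; rewrite -sqrrN !mxE opprB.
by rewrite fin_num_oppeD// oppeK.
Qed.

Definition prox_params (R : realType) (n : nat)
    (f : 'rV[R]_n -> \bar R) : set R :=
  [set lambda : R | (0 < lambda)%R /\ exists x, -oo < moreau_env lambda f x].

Definition prox_bounded (R : realType) (n : nat)
    (f : 'rV[R]_n -> \bar R) : Prop :=
  prox_params f !=set0.

Definition prox_threshold (R : realType) (n : nat)
    (f : 'rV[R]_n -> \bar R) : \bar R :=
  ereal_sup (EFin @` prox_params f).

Definition prox_avg (R : realType) (n : nat) (mu : R)
    (f g : 'rV[R]_n -> \bar R) (alpha : R) (x : 'rV[R]_n) : \bar R :=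
  - moreau_env mu (fun w => - (alpha%:E * moreau_env mu f w)
                            - ((1 - alpha)%:E * moreau_env mu g w)) x.

Definition epi_cvg (R : realType) (n : nat)
    (fk : nat -> 'rV[R]_n -> \bar R) (f : 'rV[R]_n -> \bar R) : Prop :=
  forall x : 'rV[R]_n,
    (forall xk : nat -> 'rV[R]_n, xk k @[k --> \oo] --> x ->
       f x <= limn_einf (fun k => fk k (xk k))) /\
    (exists yk : nat -> 'rV[R]_n, yk k @[k --> \oo] --> x /\
       limn_esup (fun k => fk k (yk k)) <= f x).

(* Epi-convergence of F alpha to f as alpha tends to a within A. *)
Definition epi_cvg_within (R : realType) (n : nat) (A : set R)
    (F : R -> 'rV[R]_n -> \bar R) (a : R) (f : 'rV[R]_n -> \bar R) : Prop :=
  forall ak : nat -> R, (forall k, A (ak k)) -> ak k @[k --> \oo] --> a ->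
    epi_cvg (fun k => F (ak k)) f.

Definition epi_continuous_on (R : realType) (n : nat) (A : set R)
    (F : R -> 'rV[R]_n -> \bar R) : Prop :=
  forall a, A a -> epi_cvg_within A F a (F a).

(* Main.v *)
(** Put [A w = e_mu f w - |w|^2 / (2 mu)], an infimum of affine functions of [w],
    and define [B] likewise from [g]. Then [phi^a x + |x|^2 / (2 mu)] is the
    supremum over [w] of [(a A + (1 - a) B) w + <x, w> / mu]: a convex conjugate.
    Each expression under the supremum is continuous in [(a, x)], which gives the
    liminf half of epi-convergence.

    For the recovery sequence at a point [x] where the supremum [T] is finite, a
    mixture with parameter [b] is a convex combination of the one with parameter
    [a] and of [A] or [B], so its objective at [x] is at most
    [T + |b - a| D (1 + |w|^2)]. Subtracting [e_k |w|^2] with [e_k -> 0] slightly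
    larger than [|a_k - a| D] makes the objective attain its maximum, at [w_k]
    say. By optimality [w_k] then maximizes the unpenalized objective at the
    shifted point [y_k = x - 2 mu e_k w_k], whose value is at most
    [T + |a_k - a| D], and [e_k |w_k|^2] is bounded, so that [y_k -> x]. *)

Require Import Defs.
From mathcomp Require Import all_boot all_order all_algebra.
From mathcomp Require Import all_classical all_reals all_analysis.
From mathcomp Require Import ring lra.

Import Order.TTheory GRing.Theory Num.Theory.
Import numFieldNormedType.Exports.

Set Implicit Arguments.
Unset Strict Implicit.
Unset Printing Implicit Defensive.

Local Open Scope classical_set_scope.
Local Open Scope ring_scope.

(** * The Euclidean inner product on row vectors *)

Section dot_product.
Context {R : realType} {n : nat}.
Implicit Types u v w x y : 'rV[R]_n.

Definition dotp u v : R := \sum_(i < n) u ord0 i * v ord0 i.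

Lemma dotpC u v : dotp u v = dotp v u.
Proof. by apply: eq_bigr => i _; rewrite mulrC. Qed.

Lemma dotpDl u v w : dotp (u + v) w = dotp u w + dotp v w.
Proof. by rewrite -big_split; apply: eq_bigr => i _; rewrite mxE mulrDl. Qed.

Lemma dotpZl a u v : dotp (a *: u) v = a * dotp u v.
Proof. by rewrite mulr_sumr; apply: eq_bigr => i _; rewrite mxE mulrA. Qed.

Lemma dotpDr u v w : dotp u (v + w) = dotp u v + dotp u w.
Proof. by rewrite dotpC dotpDl !(dotpC u). Qed.

Lemma dotpZr a u v : dotp u (a *: v) = a * dotp u v.
Proof. by rewrite dotpC dotpZl dotpC. Qed.

Lemma dotpNl u v : dotp (- u) v = - dotp u v.
Proof. by rewrite -scaleN1r dotpZl mulN1r. Qed.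

Lemma dotpNr u v : dotp u (- v) = - dotp u v.
Proof. by rewrite dotpC dotpNl dotpC. Qed.

Lemma dotp0r u : dotp u 0 = 0.
Proof. by rewrite -(scale0r 0) dotpZr mul0r. Qed.

Definition dotpE := (dotpDl, dotpDr, dotpNl, dotpNr, dotpZl, dotpZr).

Lemma dotp_ge0 u : 0 <= dotp u u.
Proof. by apply: sumr_ge0 => i _; rewrite -expr2 sqr_ge0. Qed.

Lemma eucl_norm_sqr u : eucl_norm u ^+ 2 = dotp u u.
Proof.
rewrite /eucl_norm; under eq_bigr do rewrite expr2.
by rewrite sqr_sqrtr ?dotp_ge0.
Qed.

Lemma sqr_coord_le u i : u ord0 i ^+ 2 <= dotp u u.
Proof.
rewrite /dotp (bigD1 i)//= expr2 lerDl.
by apply: sumr_ge0 => j _; rewrite -expr2 sqr_ge0.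
Qed.

Lemma dotp_young e u v : 0 < e ->
  dotp u v <= (2 * e)^-1 * dotp u u + e / 2 * dotp v v.
Proof.
move=> e0; have := dotp_ge0 (u - e *: v); rewrite !dotpE (dotpC v u) => h.
rewrite -(ler_pM2l (_ : 0 < 2 * e)); last by lra.
have -> : 2 * e * ((2 * e)^-1 * dotp u u + e / 2 * dotp v v) =
  dotp u u + e * e * dotp v v by field; lra.
by lra.
Qed.

Lemma cvg_dotp (T : Type) (F : set_system T) {FF : Filter F}
    (f g : T -> 'rV[R]_n) x y :
  f @ F --> x -> g @ F --> y -> dotp (f t) (g t) @[t --> F] --> dotp x y.
Proof.
move=> fx gy; apply: cvg_big => [|i _]; first exact: add_continuous.
apply: cvgM.
  exact: (cvg_comp _ (fun u : 'rV[R]_n => u ord0 i) fx (@coord_continuous _ _ _ _ _ x)).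
exact: (cvg_comp _ (fun u : 'rV[R]_n => u ord0 i) gy (@coord_continuous _ _ _ _ _ y)).
Qed.

(** The topology comes from the sup norm, and the square of each coordinate is at most
    [dotp u u]. *)
Lemma cvg_sqr_dist_0 (u : nat -> 'rV[R]_n) :
  dotp (u k) (u k) @[k --> \oo] --> 0 -> u @ \oo --> (0 : 'rV[R]_n).
Proof.
move=> h; apply/cvgrPdist_lt => e e0.
have e20 : 0 < e ^+ 2 by rewrite exprn_gt0.
have hlt := cvgr_lt _ h _ e20; near=> k.
have hk : dotp (u k) (u k) < e ^+ 2 by near: k; exact: hlt.
rewrite sub0r normrN.
rewrite [ltLHS](_ : _ = mx_norm (u k))// mx_normrE.
apply/bigmax_ltP; split => // -[i j] _ /=.
rewrite ltNge; apply/negP => ej.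
have := sqr_coord_le (u k) j; rewrite ord1 in ej.
rewrite -real_normK ?num_real// => h2.
have := le_lt_trans h2 hk.
by rewrite ltNge ler_pXn2r ?nnegrE ?normr_ge0 ?ej //; exact: ltW.
Unshelve. all: by end_near. Qed.

End dot_product.

(** * Infima of affine functions and their quadratic penalizations *)

Section upper_envelope.
Context {R : realType} {n : nat}.
Implicit Types (c d : 'rV[R]_n -> R) (u v w x y : 'rV[R]_n).

(* Instead of an indexing family: the affine majorants of [c] are arbitrarily
   tight at every point. This form is visibly stable under convex combinations. *)
Definition affine_infimum c := forall w e, 0 < e -> exists a y,
  (forall v, c v <= a + dotp y v) /\ a + dotp y w <= c w + e.

Lemma affine_infimum_convex c d s t : 0 <= s -> 0 <= t -> s + t = 1 ->
  affine_infimum c -> affine_infimum d ->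
  affine_infimum (fun w => s * c w + t * d w).
Proof.
move=> s0 t0 st1 cP dP w e e0.
have [a [y [cy yw]]] := cP w e e0; have [b [z [dz zw]]] := dP w e e0.
exists (s * a + t * b), (s *: y + t *: z); split => [v|].
  rewrite !dotpE.
  by have := ler_wpM2l s0 (cy v); have := ler_wpM2l t0 (dz v); lra.
rewrite !dotpE; have := ler_wpM2l s0 yw; have := ler_wpM2l t0 zw.
have : s * e + t * e = e by rewrite -mulrDl st1 mul1r.
by lra.
Qed.

Lemma affine_infimumD c x : affine_infimum c ->
  affine_infimum (fun w => c w + dotp x w).
Proof.
move=> cP w e /(cP w)[a [y [cy yw]]]; exists a, (y + x).
by split => [v|]; rewrite !dotpE ?addrA; [rewrite lerD2r|lra].
Qed.

(** Take a majorant tight up to [e] at the intermediate point and evaluate it at both ends. *)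
Lemma affine_infimum_concave c w v t : affine_infimum c -> 0 <= t <= 1 ->
  (1 - t) * c w + t * c v <= c (w + t *: (v - w)).
Proof.
move=> cP /andP[t0 t1]; apply/ler_addgt0Pr => e.
move=> /(cP (w + t *: (v - w)))[a [y [cy]]]; apply: le_trans.
rewrite !dotpE; have t1' : 0 <= 1 - t by lra.
by have := ler_wpM2l t0 (cy v); have := ler_wpM2l t1' (cy w); lra.
Qed.

Lemma affine_infimum_quad_bound c : affine_infimum c ->
  exists2 D, 0 <= D & forall w, c w <= D * (1 + dotp w w).
Proof.
move=> /(_ 0 1 ltr01)[a [y [cy _]]].
exists (`|a| + 1 + dotp y y); first by have := dotp_ge0 y; have := normr_ge0 a; lra.
move=> w; have := dotp_young y w (@ltr01 R); have := ler_norm a.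
have := dotp_ge0 y; have := dotp_ge0 w; have := cy w.
have := mulr_ge0 (dotp_ge0 y) (dotp_ge0 w).
have := mulr_ge0 (normr_ge0 a) (dotp_ge0 w).
lra.
Qed.

(** A single affine majorant makes the penalized function coercive, so a maximizing sequence has a
    cluster point; majorants tight there provide the upper semicontinuity. *)
Lemma affine_infimum_quad_max c e : affine_infimum c -> 0 < e ->
  exists w0, forall w, c w - e * dotp w w <= c w0 - e * dotp w0 w0.
Proof.
move=> cP e0; pose F w := c w - e * dotp w w.
(* Half of the penalty absorbs the linear part of the majorant. *)
have [K FK] : exists K, forall w, F w <= K - e / 2 * dotp w w.
  have [a [y [cy _]]] := cP 0 1 ltr01.
  exists (a + (2 * e)^-1 * dotp y y) => w; rewrite /F.
  by have := dotp_young y w e0; have := cy w; lra.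
have Fsup : has_sup (range F).
  split; first by exists (F 0), 0.
  exists K => _ [w _ <-]; apply: le_trans (FK w) _.
  by have := mulr_ge0 (ltW e0) (dotp_ge0 w); lra.
set M := sup (range F).
have FM w : F w <= M by apply: (ub_le_sup Fsup.2); exists w.
have /choice[u uM] : forall j : nat, exists w, M - harmonic j < F w.
  move=> j; have [|_ [w _ <-] ?] := sup_adherent (_ : 0 < @harmonic R j) Fsup.
    by rewrite /harmonic /= invr_gt0 ltr0n.
  by exists w.
(* Solves [M - 1 < F (u j) <= K - e / 2 * dotp (u j) (u j)] for the squared norm. *)
pose r := 2 / e * (K - M + 1).
have ur j : dotp (u j) (u j) <= r.
  have := FK (u j); have := uM j.
  have h1 : @harmonic R j <= 1 by rewrite /harmonic /= invf_le1 ?ler1n ?ltr0n.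
  move=> h2 h3; have : e / 2 * dotp (u j) (u j) <= K - M + 1 by lra.
  rewrite /r mulrC -ler_pdivlMr ?divr_gt0// => /le_trans; apply.
  by rewrite le_eqVlt; apply/orP; left; apply/eqP; field; lra.
have : compact [set v : 'rV[R]_n | forall i, (v ord0 i) \in `[- (r + 1), r + 1]].
  apply: (@rV_compact _ _ (fun=> `[- (r + 1), r + 1]%classic)) => _.
  exact: segment_compact.
move=> /(_ (u @ \oo))[|].
  exists 0%N => // j _ /= i; rewrite in_itv /= -ler_norml.
  have h := le_trans (sqr_coord_le (u j) i) (ur j).
  rewrite leNgt; apply/negP => hr.
  have r0 : 0 <= r by apply: le_trans h; rewrite sqr_ge0.
  have : (r + 1) ^+ 2 < `|u j ord0 i| ^+ 2.
    by rewrite ltrXn2r ?nnegrE// addr_ge0.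
  rewrite real_normK ?num_real// expr2.
  by have := mulr_ge0 r0 r0; lra.
move=> w0 [_ w0u]; exists w0 => w; apply: le_trans (FM w) _.
(* One third each for the tightness of the majorant at [w0], the continuity of [G], and the defect
   of [u j] from the supremum. *)
apply/ler_addgt0Pr => d d0; have d3 : 0 < d / 3 by lra.
have [a [y [cy yw0]]] := cP w0 _ d3.
pose G v := a + dotp y v - e * dotp v v.
have Gw0 : G v @[v --> nbhs w0] --> G w0.
  have idc : v @[v --> nbhs w0] --> w0 by exact: cvg_id.
  exact: (cvgB (cvgD (cvg_cst a) (cvg_dotp (cvg_cst y) idc))
    (cvgM (cvg_cst e) (cvg_dotp idc idc))).
have Gnear : nbhs w0 [set v | G v < G w0 + d / 3].
  by apply: (cvgr_lt _ Gw0); lra.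
have uF : (u @ \oo) (u @` [set j | @harmonic R j < d / 3]).
  have [N _ Nd] := cvgr_lt _ (@cvg_harmonic R) _ d3.
  by exists N => // j /Nd hj; exists j.
have [_ [[j hj <-]]] := w0u _ _ uF Gnear.
have {}hj : @harmonic R j < d / 3 by [].
rewrite /G /= => hv.
have := uM j; have := cy (u j); rewrite /F; lra.
Qed.

(* [w0] maximizes [c w - e |w|^2]; compare it with [w0 + t (w - w0)] as [t -> 0]. *)
Lemma affine_infimum_quad_argmax c e : affine_infimum c -> 0 < e ->
  exists w0, forall w, c w <= c w0 + 2 * e * dotp w0 (w - w0).
Proof.
move=> cP e0; have [w0 w0M] := affine_infimum_quad_max cP e0.
exists w0 => w; apply/ler_addgt0Pr => d d0; set h := w - w0.
have cvx t : 0 <= t <= 1 -> (1 - t) * c w0 + t * c w <= c (w0 + t *: h).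
  exact: affine_infimum_concave.
clearbody h.
have hh := mulr_ge0 (ltW e0) (dotp_ge0 h).
(* Once the factor [t] is cancelled, the second-order term [t * (e * dotp h h)] remains and must not
   exceed [d]. *)
pose t := d / (d + e * dotp h h + 1).
have t0 : 0 < t by apply: divr_gt0 => //; lra.
have t1 : t <= 1 by rewrite ler_pdivrMr; lra.
have td : t * (e * dotp h h) <= d.
  rewrite /t mulrAC ler_pdivrMr; last by lra.
  by have := mulr_ge0 (ltW d0) hh; have := mulr_ge0 (ltW d0) (ltW d0); lra.
have := w0M (w0 + t *: h).
have := cvx t; rewrite (ltW t0) t1 => /(_ isT).
rewrite !dotpE (dotpC h) => h1 h2.
have : t * (c w - c w0) <= t * (2 * e * dotp w0 h + t * (e * dotp h h)) by lra.
by rewrite ler_pM2l//; lra.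
Qed.

(** The weight moved onto [c] or [d] is [(b - a) / (1 - a)] or [(a - b) / a], at most [|b - a| * k]
    in both cases. A zero denominator never occurs: [a < b] forces [a < 1], and [b < a] forces
    [0 < a]. *)
Lemma affine_infimum_mix_bound c d a T : affine_infimum c -> affine_infimum d ->
    0 <= a <= 1 -> (forall w, a * c w + (1 - a) * d w <= T) ->
  exists2 D, 0 <= D & forall b w, 0 <= b <= 1 ->
    b * c w + (1 - b) * d w <= T + `|b - a| * D * (1 + dotp w w).
Proof.
move=> cP dP /andP[a0 a1] abT.
have [C C0 cC] := affine_infimum_quad_bound cP.
have [D D0 dD] := affine_infimum_quad_bound dP.
pose k := a^-1 + (1 - a)^-1; pose E := C + D + `|T|.
have E0 : 0 <= E by have := normr_ge0 T; rewrite /E; lra.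
have k0 : 0 <= k by rewrite addr_ge0 ?invr_ge0//; lra.
exists (k * E) => [|b w /andP[b0 b1]]; first by rewrite mulr_ge0.
have w1 : 1 <= 1 + dotp w w by have := dotp_ge0 w; lra.
(* Here [X] stands for [c w] or [d w]. Replacing [(1 - t) * T] by [T] costs at most [t * |T|], hence
   the last summand of [E]. *)
have key t X : 0 <= t <= 1 -> t <= `|b - a| * k ->
    X <= (C + D) * (1 + dotp w w) ->
    (1 - t) * (a * c w + (1 - a) * d w) + t * X <=
    T + `|b - a| * (k * E) * (1 + dotp w w).
  move=> /andP[t0 t1] tk XE; have t1' : 0 <= 1 - t by lra.
  have := ler_wpM2l t1' (abT w); have := ler_wpM2l t0 XE.
  have h1 : - T <= `|T| * (1 + dotp w w).
    by apply: le_trans (ler_norm _) _; rewrite normrN ler_peMr.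
  have := ler_wpM2l t0 h1.
  have := ler_wpM2r (mulr_ge0 E0 (le_trans ler01 w1)) tk.
  by rewrite /E; lra.
have [ba|ab|->] := ltgtP b a; last first.
- by have := abT w; rewrite subrr normr0 !mul0r addr0.
- have a1' : 0 < 1 - a by lra.
  have -> : b * c w + (1 - b) * d w = (1 - (b - a) / (1 - a)) *
      (a * c w + (1 - a) * d w) + (b - a) / (1 - a) * c w by field; lra.
  apply: key.
  + by apply/andP; split; [apply: divr_ge0; lra|rewrite ler_pdivrMr//; lra].
  + by rewrite gtr0_norm ?subr_gt0// ler_pM2l ?subr_gt0// lerDr invr_ge0.
  + by rewrite mulrDl; have := cC w; have := mulr_ge0 D0 (le_trans ler01 w1); lra.
- have a0' : 0 < a by lra.
  have -> : b * c w + (1 - b) * d w = (1 - (a - b) / a) *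
      (a * c w + (1 - a) * d w) + (a - b) / a * d w by field; lra.
  apply: key.
  + by apply/andP; split; [apply: divr_ge0; lra|rewrite ler_pdivrMr//; lra].
  + rewrite ltr0_norm ?subr_lt0// opprB ler_pM2l ?subr_gt0// lerDl invr_ge0.
    by rewrite subr_ge0.
  + by rewrite mulrDl; have := dD w; have := mulr_ge0 C0 (le_trans ler01 w1); lra.
Qed.

End upper_envelope.

Local Open Scope ereal_scope.

(** * Monotonicity of extended lower and upper limits *)

Section limn_monotone.
Context {R : realType}.
Implicit Types u v : nat -> \bar R.

Lemma le_limn_esup u v : (forall k, u k <= v k) -> limn_esup u <= limn_esup v.
Proof.
move=> uv; rewrite /limn_esup !limf_esupE.
apply: le_ereal_inf_tmp => _ [V FV <-]; apply: ge_ereal_inf.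
exists (ereal_sup (u @` V)); first by exists V.
apply: ge_ereal_sup => _ [k Vk <-]; apply: le_ereal_sup_tmp.
by exists (v k) => //; exists k.
Qed.

Lemma le_limn_einf u v : (forall k, u k <= v k) -> limn_einf u <= limn_einf v.
Proof. by move=> uv; rewrite leeN2; apply: le_limn_esup => k; rewrite leeN2. Qed.

End limn_monotone.

(** * Epi-convergence of conjugates of mixtures *)

Section conjugate_mix.
Context {R : realType} {n : nat}.
Variables (nu : R) (A B : 'rV[R]_n -> R).
Hypotheses (nu_gt0 : (0 < nu)%R) (AP : affine_infimum A) (BP : affine_infimum B).

(* With [nu = 1 / (2 mu)]. *)
Definition conjugate_mix (a : R) (x : 'rV[R]_n) : \bar R :=
  ereal_sup (range (fun w =>
    (a * A w + (1 - a) * B w + 2 * nu * dotp x w - nu * dotp x x)%:E)).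

Lemma conjugate_mix_liminf (ak : nat -> R) (a : R)
    (xk : nat -> 'rV[R]_n) (x : 'rV[R]_n) :
  ak k @[k --> \oo] --> a -> xk k @[k --> \oo] --> x ->
  conjugate_mix a x <= limn_einf (fun k => conjugate_mix (ak k) (xk k)).
Proof.
move=> aka xkx; apply: ge_ereal_sup => _ [w _ <-].
pose v k := (ak k * A w + (1 - ak k) * B w + 2 * nu * dotp (xk k) w
  - nu * dotp (xk k) (xk k))%R.
have vl : v k @[k --> \oo] -->
    (a * A w + (1 - a) * B w + 2 * nu * dotp x w - nu * dotp x x)%R.
  exact: (cvgB (cvgD (cvgD (cvgM aka (cvg_cst (A w)))
    (cvgM (cvgB (cvg_cst (1%R : R)) aka) (cvg_cst (B w))))
    (cvgM (cvg_cst (2 * nu)%R) (cvg_dotp xkx (cvg_cst w))))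
    (cvgM (cvg_cst nu) (cvg_dotp xkx xkx))).
have /cvg_limn_einf_sup[<- _] : (v k)%:E @[k --> \oo] -->
    (a * A w + (1 - a) * B w + 2 * nu * dotp x w - nu * dotp x x)%:E.
  by apply: cvg_EFin; [exact: nearW|exact: vl].
by apply: le_limn_einf => k; apply: ereal_sup_ubound; exists w.
Qed.

Lemma conjugate_mix_recovery (ak : nat -> R) (a : R) (x : 'rV[R]_n) :
    (forall k, 0 <= ak k <= 1)%R -> (0 <= a <= 1)%R -> ak k @[k --> \oo] --> a ->
  exists yk : nat -> 'rV[R]_n, yk k @[k --> \oo] --> x /\
    limn_esup (fun k => conjugate_mix (ak k) (yk k)) <= conjugate_mix a x.
Proof.
move=> ak01 a01 aka.
have [->|phi_fin] := eqVneq (conjugate_mix a x) +oo.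
  by exists (fun=> x); split; [exact: cvg_cst|exact: leey].
have {phi_fin}[r phiE] : exists r, conjugate_mix a x = r%:E.
  move: phi_fin; case E : (conjugate_mix a x) => [r| |]// _; first by exists r.
  by move/ereal_sup_ninfty : E => /(_ _ (ex_intro2 _ _ 0%R I erefl)).
(* Since the weights sum to 1, the linear term can be added to both [A] and [B]; [T] then bounds
   their mixture. *)
pose T := (r + nu * dotp x x)%R.
pose A' w := (A w + dotp ((2 * nu) *: x) w)%R.
pose B' w := (B w + dotp ((2 * nu) *: x) w)%R.
have A'P : affine_infimum A' by exact: affine_infimumD.
have B'P : affine_infimum B' by exact: affine_infimumD.
have mixT w : (a * A' w + (1 - a) * B' w <= T)%R.
  have : (a * A w + (1 - a) * B w + 2 * nu * dotp x w - nu * dotp x x)%:E <= r%:E.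
    by rewrite -phiE; apply: ereal_sup_ubound; exists w.
  by rewrite lee_fin /T /A' /B' !dotpE; lra.
have [D D0 mixD] := affine_infimum_mix_bound A'P B'P a01 mixT.
(* The harmonic term keeps [e k] positive even when [s k * D] vanishes. *)
pose s k := `|ak k - a|%R; pose e k := (s k * D + harmonic k)%R.
have s0 k : (0 <= s k)%R by exact: normr_ge0.
have h0 k : (0 < @harmonic R k)%R by rewrite /harmonic /= invr_gt0 ltr0n.
have e0 k : (0 < e k)%R by rewrite /e; have := mulr_ge0 (s0 k) D0; have := h0 k; lra.
have s_cvg : s k @[k --> \oo] --> 0%R.
  rewrite -(normr0 R) -(subrr a); exact: cvg_norm (cvgB aka (cvg_cst a)).
have e_cvg : e k @[k --> \oo] --> 0%R.
  rewrite -[0%R]addr0 -[X in (X + _)%R](mul0r D).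
  exact: (cvgD (cvgM s_cvg (cvg_cst D)) cvg_harmonic).
have /choice[w wP] : forall k, exists w0, forall w, (ak k * A' w + (1 - ak k) * B' w <=
    ak k * A' w0 + (1 - ak k) * B' w0 + 2 * e k * dotp w0 (w - w0))%R.
  move=> k; apply: (affine_infimum_quad_argmax _ (e0 k)).
  have /andP[? ?] := ak01 k.
  by apply: affine_infimum_convex => //; lra.
have sD k : (s k * D * dotp (w k) (w k) <= e k * dotp (w k) (w k))%R.
  by rewrite ler_wpM2r ?dotp_ge0// /e lerDl ltW.
(* Optimality of [w k] against 0 gains [2 * e k * dotp (w k) (w k)], while [mixD] loses at most
   [D + e k * dotp (w k) (w k)], as [s k <= 1]. *)
pose K := (T + D + `|A' 0| + `|B' 0|)%R.
have ewK k : (e k * dotp (w k) (w k) <= K)%R.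
  have /andP[k0 k1] := ak01 k; have /andP[a0 a1] := a01.
  have s1 : (s k <= 1)%R by rewrite ler_norml; lra.
  have := ler_wpM2r D0 s1; have := sD k.
  have := mixD _ (w k) (ak01 k); have := wP k 0%R; rewrite -/(s k) !dotpE dotp0r.
  have h1 : (- (ak k * A' 0) <= `|A' 0|)%R.
    rewrite -mulrN; apply: le_trans (ler_norm _) _.
    by rewrite normrM normrN (ger0_norm k0) ler_piMl.
  have h2 : (- ((1 - ak k) * B' 0) <= `|B' 0|)%R.
    rewrite -mulrN; apply: le_trans (ler_norm _) _.
    by rewrite normrM normrN ger0_norm ?subr_ge0// ler_piMl// lerBlDr lerDl.
  rewrite /K; lra.
have ew_cvg : (e k *: w k)%R @[k --> \oo] --> (0%R : 'rV[R]_n).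
  (* The squared norm is [e k] times a quantity bounded by [K]. *)
  apply: cvg_sqr_dist_0.
  apply: (@squeeze_cvgr _ _ _ _ (fun=> 0%R) (fun k => e k * K)%R).
  - near=> k; rewrite dotp_ge0 /= !dotpE.
    by have := ler_wpM2l (ltW (e0 k)) (ewK k).
  - exact: cvg_cst.
  - by rewrite -[0%R](mul0r K); exact: (cvgM e_cvg (cvg_cst K)).
(* This shift subtracts the slope [2 * e k *: w k] from the objective, which turns [wP] into
   maximality of [w k]. *)
pose y k := (x - nu^-1 *: (e k *: w k))%R.
have y_cvg : y k @[k --> \oo] --> x.
  rewrite -[x in _ --> x]subr0 -(scaler0 _ nu^-1).
  exact: (cvgB (cvg_cst x) (cvgZr ew_cvg)).
exists y; split=> //.
pose u k := (T + s k * D - nu * dotp (y k) (y k))%R.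
have u_cvg : u k @[k --> \oo] --> r.
  have -> : r = (T + 0 * D - nu * dotp x x)%R by rewrite /T mul0r; ring.
  exact: (cvgB (cvgD (cvg_cst T) (cvgM s_cvg (cvg_cst D)))
    (cvgM (cvg_cst nu) (cvg_dotp y_cvg y_cvg))).
have /cvg_limn_einf_sup[_ ul] : (u k)%:E @[k --> \oo] --> r%:E.
  by apply: cvg_EFin; [exact: nearW|exact: u_cvg].
rewrite phiE -ul; apply: le_limn_esup => k; apply: ge_ereal_sup => _ [v _ <-].
rewrite lee_fin /u lerD2r.
have -> : (2 * nu * dotp (y k) v = dotp ((2 * nu) *: x) v - 2 * e k * dotp (w k) v)%R.
  by rewrite /y !dotpE; field; rewrite gt_eqF.
have := wP k v; have := mixD _ (w k) (ak01 k); have := sD k.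
have := mulr_ge0 (ltW (e0 k)) (dotp_ge0 (w k)).
rewrite -/(s k) /A' /B' !dotpE; lra.
Unshelve. all: by end_near. Qed.

End conjugate_mix.

(** * Moreau envelopes as infima of affine functions *)

Section moreau_envelope.
Context {R : realType} {n : nat}.
Implicit Types (mu : R) (f g : 'rV[R]_n -> \bar R).

(** Some admissible [lam] exceeds [mu], so [f] is minorized by [m - q], and the steeper
    [mu]-quadratic dominates [q] up to a constant. *)
Lemma moreau_env_fin mu f : proper_fun f -> (0 < mu)%R ->
  mu%:E < prox_threshold f -> forall w, moreau_env mu f w \is a fin_num.
Proof.
move=> [f_gtNy [y0 fy0]] mu0 /ereal_sup_gt[_ [lam [lam0 [x0 xNy]] <-]].
rewrite lte_fin => mulam w.
have fy0' : f y0 \is a fin_num by rewrite fin_real// f_gtNy fy0.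
rewrite fin_real//; apply/andP; split; last first.
  apply: le_lt_trans (_ : f y0 + ((2 * mu)^-1 * eucl_norm (y0 - w) ^+ 2)%:E < +oo).
    by apply: ereal_inf_lbound; exists y0.
  by rewrite -(fineK fy0') -EFinD ltry.
pose q v := ((2 * lam)^-1 * dotp (v - x0) (v - x0))%R.
have [m mf] : exists m : R, forall v, m%:E <= f v + (q v)%:E.
  have lb v : moreau_env lam f x0 <= f v + (q v)%:E.
    by rewrite /q -eucl_norm_sqr; apply: ereal_inf_lbound; exists v.
  move: lb xNy; case: (moreau_env lam f x0) => [m| |] lb // _; first by exists m.
  by have := lb y0; rewrite -(fineK fy0') -EFinD leye_eq.
pose z := (w - x0)%R.
(* With [u = v - w], [- C] is the minimum over [u] of the [mu]-quadratic at [u] minus the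
   [lam]-quadratic at [u + z], attained where [(lam - mu) *: u = mu *: z]; the square expanded below
   vanishes exactly there. *)
pose C := ((2 * (lam - mu))^-1 * dotp z z)%R.
apply: lt_le_trans (_ : (m - C)%:E <= _); first exact: ltNyr.
apply: le_ereal_inf_tmp => _ [v _ <-]; rewrite eucl_norm_sqr.
have /le_trans -> // : (m - C)%:E <=
    (m - q v + (2 * mu)^-1 * dotp (v - w) (v - w))%:E.
  rewrite lee_fin; set u := (v - w)%R.
  have -> : q v = ((2 * lam)^-1 * dotp (u + z) (u + z))%R.
    by rewrite /q /u /z addrA subrK.
  rewrite /C; clear C; clearbody u z; rewrite !dotpE (dotpC z u).
  have l0 : (0 < lam - mu)%R by lra.
  have := dotp_ge0 ((lam - mu) *: u - mu *: z)%R; rewrite !dotpE (dotpC z u) => h.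
  have k0 : (0 <= (2 * lam * mu * (lam - mu))^-1)%R.
    by rewrite invr_ge0 !mulr_ge0//; lra.
  have := mulr_ge0 k0 h; rewrite [X in (0 <= X)%R -> _](_ : _ =
    (2 * mu)^-1 * dotp u u + (2 * (lam - mu))^-1 * dotp z z
    - (2 * lam)^-1 * (dotp u u + dotp u z + (dotp u z + dotp z z)))%R; first lra.
  by field; rewrite !gt_eqF.
rewrite EFinD leeD2r// EFinB leeBlDr//; exact: mf.
Qed.

(* Minus the convex conjugate of [f + |.|^2 / (2 mu)], at [w / mu]. *)
Definition concave_part mu f w : R :=
  (fine (moreau_env mu f w) - (2 * mu)^-1 * dotp w w)%R.

(** For fixed [v], subtracting the square of [w] from the term of the envelope leaves an affine
    function of [w]; a near-minimizing [v] gives tightness. *)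
Lemma concave_part_affine_infimum mu f : proper_fun f ->
  (forall w, moreau_env mu f w \is a fin_num) ->
  affine_infimum (concave_part mu f).
Proof.
move=> [f_gtNy _] f_fin w e e0.
have [_ [v _ <-]] := lb_ereal_inf_adherent e0 (f_fin w).
rewrite -/(moreau_env mu f w) -(fineK (f_fin w)) -EFinD => vlt.
have [r fv] : exists r, f v = r%:E.
  by move: vlt (f_gtNy v); case: (f v) => [r _ _| |]//; exists r.
exists (r + (2 * mu)^-1 * dotp v v)%R, (- (2 * (2 * mu)^-1) *: v)%R.
move: vlt; rewrite fv -EFinD lte_fin eucl_norm_sqr !dotpE (dotpC w v) => vlt.
split=> [z|]; rewrite /concave_part ?dotpE; last by lra.
have : moreau_env mu f z <= f v + ((2 * mu)^-1 * eucl_norm (v - z) ^+ 2)%:E.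
  by apply: ereal_inf_lbound; exists v.
rewrite -(fineK (f_fin z)) fv -EFinD lee_fin eucl_norm_sqr !dotpE (dotpC z v).
lra.
Qed.

(** The weights sum to 1, so the squares of [w] removed in the two concave parts add up to the one
    in the outer envelope. *)
Lemma prox_avgE mu f g : (forall w, moreau_env mu f w \is a fin_num) ->
  (forall w, moreau_env mu g w \is a fin_num) ->
  prox_avg mu f g =2
  conjugate_mix (2 * mu)^-1 (concave_part mu f) (concave_part mu g).
Proof.
move=> f_fin g_fin a x.
rewrite /prox_avg {1}/moreau_env ereal_infEN oppeK image_comp.
congr ereal_sup; apply: eq_imagel => w _ /=.
rewrite -(fineK (f_fin w)) -(fineK (g_fin w)) -!(EFinM, EFinN, EFinD, EFinB).
by rewrite /concave_part eucl_norm_sqr !dotpE (dotpC w x); congr EFin; lra.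
Qed.

Lemma prox_avg0 mu f g : prox_avg mu f g 0 = proximal_hull mu g.
Proof.
apply/funext => x; rewrite proximal_hullE /prox_avg; congr (- moreau_env _ _ _).
by apply/funext => w; rewrite mul0e oppe0 subr0 mul1e add0e.
Qed.

Lemma prox_avg1 mu f g : prox_avg mu f g 1 = proximal_hull mu f.
Proof.
apply/funext => x; rewrite proximal_hullE /prox_avg; congr (- moreau_env _ _ _).
by apply/funext => w; rewrite subrr mul0e mul1e sube0.
Qed.

End moreau_envelope.

Theorem corollary6p10 (R : realType) (n : nat) (f g : 'rV[R]_n -> \bar R)
    (mu : R)
    (f_proper : proper_fun f) (g_proper : proper_fun g)
    (f_lsc : lower_semicontinuous f)
    (g_lsc : lower_semicontinuous g)
    (f_pb : prox_bounded f) (g_pb : prox_bounded g)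
    (mu_gt0 : (0 < mu)%R)
    (mu_lt : mu%:E < mine (prox_threshold f) (prox_threshold g)) :
  epi_continuous_on `[0%R, 1%R] (prox_avg mu f g) /\
  epi_cvg_within `[0%R, 1%R] (prox_avg mu f g) 0%R (proximal_hull mu g) /\
  epi_cvg_within `[0%R, 1%R] (prox_avg mu f g) 1%R (proximal_hull mu f).
Proof.
move: mu_lt; rewrite lt_min => /andP[muf mug].
have f_fin := moreau_env_fin f_proper mu_gt0 muf.
have g_fin := moreau_env_fin g_proper mu_gt0 mug.
have fP := concave_part_affine_infimum f_proper f_fin.
have gP := concave_part_affine_infimum g_proper g_fin.
have nu_gt0 : (0 < (2 * mu)^-1)%R by rewrite invr_gt0; lra.
have avgE : prox_avg mu f g =
    conjugate_mix (2 * mu)^-1 (concave_part mu f) (concave_part mu g).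
  by apply/funext => a; apply/funext => x; exact: prox_avgE.
have cont : epi_continuous_on `[0%R, 1%R] (prox_avg mu f g).
  rewrite avgE => a /=; rewrite in_itv/= => a01 ak ak01 aka x; split=> [xk xkx|].
    exact: conjugate_mix_liminf.
  have ak01' k : (0 <= ak k <= 1)%R by have := ak01 k; rewrite /= in_itv.
  exact: conjugate_mix_recovery.
(* The hulls are the averages at the endpoints, so continuity at 0 and 1 gives the last two
   claims. *)
rewrite -(prox_avg0 mu f g) -(prox_avg1 mu f g).
by split=> //; split; apply: cont; rewrite /= in_itv/= ?lexx ler01.
Qed.
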